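(* Let $H$ be a group, let $G \subseteq U_n$ be a subgroup which is a closed geodesic subset of $U_n$, and let $\phi, \rho : H \to G$ be two group homomorphisms. If there is a $u \in G$ such that $\mathrm{radius}_\infty(\{\phi(h)u\rho(h)^{-1} : h \in H\}) < \pi/2$ (radius computed in $G$ with respect to $d_\infty$), then there is $g \in G$ such that $$\phi(h) = g\rho(h)g^{-1}$$ for all $h \in H$.
   Context: $U_n$ is the unitary group, $\mathfrak{u}_n$ the skew-Hermitian matrices, $\|x\|_\infty$ the operator norm. $d_\infty(u,v)$ is the infimum of $\int\|\dot\alpha(t)\|_\infty\,dt$ over piecewise smooth curves in $U_n$ joining $u$ and $v$ (a bi-invariant metric). For $d_\infty(u,v)<\pi$, $\gamma_{u,v}(t)=u\exp(t\log(u^{-1}v))$, $t\in[0,1]$, where $\log(w)$ is the unique $y\in\mathfrak{u}_n$ with $\|y\|_\infty<\pi$, $e^y=w$. A geodesic subset is a set $M\subseteq U_n$ any two points of which are joined by a piecewise smooth path in $M$ and such that $\gamma_{u,v}\subseteq M$ whenever $u,v\in M$ and $d_\infty(u,v)<\pi$. For $A\subseteq G$, $\mathrm{radius}_\infty(A)=\inf\{r:\exists c\in G,\ d_\infty(c,a)\le r\ \forall a\in A\}$. *)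

(* Defs.v *)
From HB Require Import structures.
From mathcomp Require Import all_boot all_order all_algebra.
From mathcomp Require Import complex.
From mathcomp Require Import all_classical all_reals all_analysis.
Set Implicit Arguments. Unset Strict Implicit. Unset Printing Implicit Defensive.
Import Order.TTheory GRing.Theory Num.Theory.
Import numFieldNormedType.Exports.
Local Open Scope classical_set_scope.
Local Open Scope ring_scope.

Section Unitary.
Variables (R : realType) (n : nat).

Local Notation mx := 'M[R[i]]_n.

Definition adj (x : mx) : mx := (map_mx Num.conj x)^T.

Definition unitary (x : mx) : Prop := adj x *m x = 1%:M.
Definition skew_herm (y : mx) : Prop := adj y = - y.

Definition vnorm (v : 'cV[R[i]]_n) : R :=
  Num.sqrt (\sum_(i < n) (complex.Re (v i 0) ^+ 2 + complex.Im (v i 0) ^+ 2)).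

Definition opnorm (x : mx) : R :=
  sup [set vnorm (x *m v) | v in [set v : 'cV[R[i]]_n | vnorm v <= 1]].

Definition mxRI (x : mx) : 'M[R]_n * 'M[R]_n := (map_mx (@complex.Re R) x, map_mx (@complex.Im R) x).

Definition mxpow (x : mx) (k : nat) : mx := iter k (mulmx x) 1%:M.
Definition expm_partial (x : mx) (N : nat) : mx :=
  \sum_(k < N) ((k`!%:R)^-1 : R[i]) *: mxpow x k.
Definition expm (x : mx) : mx :=
  \matrix_(i, j) Complex (lim (complex.Re (expm_partial x N i j) @[N --> \oo]))
                         (lim (complex.Im (expm_partial x N i j) @[N --> \oo])).

(* log w: the unique skew-Hermitian y with ||y||_oo < pi and exp y = w *)
Definition is_log (w y : mx) : Prop :=
  skew_herm y /\ opnorm y < pi /\ expm y = w.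

Definition smooth_fun (f : R -> R) : Prop :=
  forall (k : nat) (t : R), derivable (iter k (@derive1 R R) f) t 1.
Definition smooth_curve (b : R -> mx) : Prop :=
  forall i j, smooth_fun (fun t => complex.Re (b t i j)) /\ smooth_fun (fun t => complex.Im (b t i j)).
Definition dcurve (b : R -> mx) (t : R) : mx :=
  \matrix_(i, j) Complex (derive1 (fun s => complex.Re (b s i j)) t) (derive1 (fun s => complex.Im (b s i j)) t).

Definition pw_path (M : set mx) (u v : mx) (a : R -> mx)
    (k : nat) (ts : nat -> R) (bs : nat -> R -> mx) : Prop :=
  [/\ [/\ (0 < k)%N, ts 0%N = 0, ts k = 1 &
          forall i, (i < k)%N -> ts i < ts i.+1],
      a 0 = u /\ a 1 = v,
      forall t, 0 <= t <= 1 -> M (a t) &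
      forall i, (i < k)%N -> smooth_curve (bs i) /\
        forall t, ts i <= t <= ts i.+1 -> a t = bs i t].

Definition pw_length (k : nat) (ts : nat -> R) (bs : nat -> R -> mx) : \bar R :=
  (\sum_(i < k) \int[@lebesgue_measure R]_(t in `[ts i, ts i.+1])
       (opnorm (dcurve (bs i) t))%:E)%E.

Definition dinf (u v : mx) : \bar R :=
  ereal_inf [set L | exists a k ts bs,
     pw_path [set x | unitary x] u v a k ts bs /\ L = pw_length k ts bs].

Definition geodesic_subset (M : set mx) : Prop :=
  (forall u v, M u -> M v -> exists a k ts bs, pw_path M u v a k ts bs) /\
  (forall u v, M u -> M v -> (dinf u v < pi%:E)%E ->
     forall y, is_log (invmx u *m v) y ->
     forall t, 0 <= t <= 1 -> M (u *m expm ((t%:C)%C *: y))).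

(* closed subset of U_n (equivalently of C^{n x n}) *)
Definition closed_mx (M : set mx) : Prop := closed (mxRI @` M).

Definition subgroup_Un (G : set mx) : Prop :=
  [/\ forall x, G x -> unitary x, G 1%:M,
      forall x y, G x -> G y -> G (x *m y) &
      forall x, G x -> G (invmx x)].

Definition radius_in (G A : set mx) : \bar R :=
  ereal_inf [set r%:E | r in [set r : R | exists c, G c /\
                 forall a, A a -> (dinf c a <= r%:E)%E]].

End Unitary.

(* Main.v *)
(* A path of length L < pi/2 in U_n from c to a moves each unit vector c v by an
   angle at most L on the sphere, so cos(r') |v|^2 <= Re <c v, a v> for every
   a in the orbit O = {phi(h) u rho(h)^-1}. Let kappa = cos(r') and let C be the
   set of g in G with kappa |v|^2 <= Re <g v, a v> for all a in O and all v.
   For g1, g2 in C the unitary g1^-1 g2 has no eigenvalue -1, so the geodesic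
   midpoint m = g1 exp(log(g1^-1 g2) / 2) is defined and lies in G. As
   g1 + g2 = m P with 0 <= P <= 2 commuting with g1^-1 g2, m is again in C, and
     Re tr(a^* m) >= (Re tr(a^* g1) + Re tr(a^* g2)) / 2 + kappa/8 |g1 - g2|^2.
   Hence maximising sequences of g |-> inf_(a in O) Re tr(a^* g) on C are Cauchy
   for the Hilbert-Schmidt norm, and any two of them have the same limit g in G.
   The map x |-> phi(h) x rho(h)^-1 preserves C and the functional, so it
   fixes g. *)
Require Import Defs.
From HB Require Import structures.
From mathcomp Require Import all_boot all_order all_algebra.
From mathcomp Require Import complex ring lra.
From mathcomp Require Import all_classical all_reals all_analysis.
From mathcomp Require Import measurable_realfun.
Import Order.TTheory GRing.Theory Num.Theory.
Import numFieldNormedType.Exports.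
Local Open Scope classical_set_scope.
Local Open Scope ring_scope.
Set Implicit Arguments. Unset Strict Implicit. Unset Printing Implicit Defensive.

(** * The real Hilbert-Schmidt inner product and unitary matrices *)

Section HilbertSchmidt.
Variable R : realType.
Local Notation C := R[i].
Implicit Types m n p : nat.

(** Rectangular version of [adj], so that columns have adjoints too; on square matrices the two are
    convertible. *)
Definition ctr m p (x : 'M[C]_(m, p)) : 'M[C]_(p, m) := (map_mx Num.conj x)^T.
Arguments ctr {m p} x.

(** On columns this is the real part of the Hermitian product. One real symmetric form thus serves
    both the sphere and the trace functional. *)
Definition hs m p (x y : 'M[C]_(m, p)) : R := complex.Re (\tr (ctr x *m y)).
Arguments hs {m p} x y.

Lemma ReD (a b : C) : complex.Re (a + b) = complex.Re a + complex.Re b.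
Proof. by case: a; case: b. Qed.

Lemma ImD (a b : C) : complex.Im (a + b) = complex.Im a + complex.Im b.
Proof. by case: a; case: b. Qed.

Lemma ReN (a : C) : complex.Re (- a) = - complex.Re a.
Proof. by case: a. Qed.

Lemma ImN (a : C) : complex.Im (- a) = - complex.Im a.
Proof. by case: a. Qed.

Lemma ReM (a b : C) : complex.Re (a * b) =
  complex.Re a * complex.Re b - complex.Im a * complex.Im b.
Proof. by case: a; case: b. Qed.

Lemma ImM (a b : C) : complex.Im (a * b) =
  complex.Re a * complex.Im b + complex.Im a * complex.Re b.
Proof. by case: a; case: b. Qed.

Lemma Re_conj (a : C) : complex.Re (Num.conj a) = complex.Re a.
Proof. by case: a. Qed.

Lemma Im_conj (a : C) : complex.Im (Num.conj a) = - complex.Im a.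
Proof. by case: a. Qed.

Lemma Re_realM (a : R) (b : C) : complex.Re (a%:C%C * b) = a * complex.Re b.
Proof. by rewrite ReM /= mul0r subr0. Qed.

Lemma Im_realM (a : R) (b : C) : complex.Im (a%:C%C * b) = a * complex.Im b.
Proof. by rewrite ImM /= mul0r addr0. Qed.

Lemma Re_sum (I : Type) (r : seq I) (P : pred I) (F : I -> C) :
  complex.Re (\sum_(i <- r | P i) F i) = \sum_(i <- r | P i) complex.Re (F i).
Proof. by apply: (big_morph _ ReD). Qed.

Lemma Im_sum (I : Type) (r : seq I) (P : pred I) (F : I -> C) :
  complex.Im (\sum_(i <- r | P i) F i) = \sum_(i <- r | P i) complex.Im (F i).
Proof. by apply: (big_morph _ ImD). Qed.

Lemma complex_ext (a b : C) :
  complex.Re a = complex.Re b -> complex.Im a = complex.Im b -> a = b.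
Proof. by case: a => ? ?; case: b => ? ? /= -> ->. Qed.

Lemma ctrK m p : cancel (@ctr m p) (@ctr p m).
Proof. by move=> x; apply/matrixP => i j; rewrite !mxE conjCK. Qed.

Lemma ctrM m n p (x : 'M[C]_(m, n)) (y : 'M[C]_(n, p)) :
  ctr (x *m y) = ctr y *m ctr x.
Proof. by rewrite /ctr map_mxM trmx_mul. Qed.

Lemma ctr_diag n (d : 'rV[C]_n) : ctr (diag_mx d) = diag_mx (map_mx Num.conj d).
Proof. by rewrite /ctr map_diag_mx tr_diag_mx. Qed.

Lemma hsE m p (x y : 'M[C]_(m, p)) : hs x y =
  \sum_i \sum_j (complex.Re (x i j) * complex.Re (y i j)
                 + complex.Im (x i j) * complex.Im (y i j)).
Proof.
rewrite /hs /mxtrace Re_sum exchange_big; apply: eq_bigr => j _ /=.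
rewrite !mxE Re_sum; apply: eq_bigr => i _.
by rewrite !mxE ReM Re_conj Im_conj mulNr opprK.
Qed.

Lemma hsC m p (x y : 'M[C]_(m, p)) : hs x y = hs y x.
Proof.
rewrite !hsE; apply: eq_bigr => i _; apply: eq_bigr => j _.
by rewrite mulrC [X in _ + X]mulrC.
Qed.

Lemma hsDr m p (x y z : 'M[C]_(m, p)) : hs x (y + z) = hs x y + hs x z.
Proof. by rewrite /hs mulmxDr mxtraceD ReD. Qed.

Lemma hsNr m p (x y : 'M[C]_(m, p)) : hs x (- y) = - hs x y.
Proof. by rewrite /hs mulmxN raddfN ReN. Qed.

Lemma hsDl m p (x y z : 'M[C]_(m, p)) : hs (x + y) z = hs x z + hs y z.
Proof. by rewrite hsC hsDr hsC [hs z y]hsC. Qed.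

Lemma hsNl m p (x y : 'M[C]_(m, p)) : hs (- x) y = - hs x y.
Proof. by rewrite hsC hsNr hsC. Qed.

Lemma hsZr m p (a : R) (x y : 'M[C]_(m, p)) : hs x (a%:C%C *: y) = a * hs x y.
Proof. by rewrite /hs -scalemxAr mxtraceZ Re_realM. Qed.

Lemma hsZl m p (a : R) (x y : 'M[C]_(m, p)) : hs (a%:C%C *: x) y = a * hs x y.
Proof. by rewrite hsC hsZr hsC. Qed.

Lemma hsNN m p (x : 'M[C]_(m, p)) : hs (- x) (- x) = hs x x.
Proof. by rewrite hsNr hsNl opprK. Qed.

Lemma hs_mulml m n p (a : 'M[C]_(m, n)) (x : 'M[C]_(m, p)) (y : 'M[C]_(n, p)) :
  hs (ctr a *m x) y = hs x (a *m y).
Proof. by rewrite /hs ctrM ctrK mulmxA. Qed.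

Lemma hs_mulmr m n p (a : 'M[C]_(n, p)) (x : 'M[C]_(m, p)) (y : 'M[C]_(m, n)) :
  hs (x *m ctr a) y = hs x (y *m a).
Proof. by rewrite /hs ctrM ctrK mulmxA -mulmxA mxtrace_mulC. Qed.

Lemma hs_ge0 m p (x : 'M[C]_(m, p)) : 0 <= hs x x.
Proof.
rewrite hsE; apply: sumr_ge0 => i _; apply: sumr_ge0 => j _.
by rewrite -!expr2 addr_ge0 // sqr_ge0.
Qed.

Lemma entry_le_hs m p (x : 'M[C]_(m, p)) i j :
  complex.Re (x i j) ^+ 2 + complex.Im (x i j) ^+ 2 <= hs x x.
Proof.
rewrite hsE (bigD1 i) //= (bigD1 j) //= -!expr2 -addrA lerDl addr_ge0 //.
  by apply: sumr_ge0 => k _; rewrite -!expr2 addr_ge0 // sqr_ge0.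
apply: sumr_ge0 => k _; apply: sumr_ge0 => l _.
by rewrite -!expr2 addr_ge0 // sqr_ge0.
Qed.

Lemma hs_gt0 m p (x : 'M[C]_(m, p)) : x != 0 -> 0 < hs x x.
Proof.
move=> x0; rewrite lt_neqAle hs_ge0 andbT eq_sym; apply: contra x0 => /eqP x0.
apply/eqP/matrixP => i j; rewrite mxE.
have := entry_le_hs x i j; rewrite x0 => h.
have /eqP : complex.Re (x i j) ^+ 2 + complex.Im (x i j) ^+ 2 = 0.
  by apply/le_anti; rewrite h addr_ge0 // sqr_ge0.
rewrite paddr_eq0 ?sqr_ge0 // !sqrf_eq0 => /andP[/eqP ? /eqP ?].
exact: complex_ext.
Qed.

Lemma hs_CS m p (x y : 'M[C]_(m, p)) : hs x y ^+ 2 <= hs x x * hs y y.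
Proof.
have [->|y0] := eqVneq y 0.
  have h0 : hs x 0 = 0 :> R by rewrite /hs mulmx0 raddf0.
  by rewrite h0 expr0n /= mulr_ge0 ?hs_ge0 // .
have yp := hs_gt0 y0.
(* The squared norm of this combination is c (a c - b^2), with c > 0. *)
have := hs_ge0 ((hs y y)%:C%C *: x - (hs x y)%:C%C *: y).
rewrite !(hsDr, hsDl, hsNr, hsNl, hsZr, hsZl) [hs y x]hsC.
set a := hs x x; set b := hs x y; set c := hs y y in yp *.
rewrite [X in 0 <= X](_ : _ = c * (a * c - b ^+ 2)); last by ring.
by rewrite pmulr_rge0 // subr_ge0.
Qed.

Lemma hs_sqB m p (x y : 'M[C]_(m, p)) :
  hs (x - y) (x - y) = hs x x - 2 * hs x y + hs y y.
Proof. rewrite !(hsDr, hsDl, hsNr, hsNl) [hs y x]hsC; ring. Qed.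

Lemma unitaryE n (w : 'M[C]_n) : unitary w = (ctr w *m w = 1%:M).
Proof. by []. Qed.

Lemma unitary_mulV n (w : 'M[C]_n) : unitary w -> w *m ctr w = 1%:M.
Proof. by move=> hw; apply: mulmx1C. Qed.

Lemma unitary_invmx n (w : 'M[C]_n) : unitary w -> invmx w = ctr w.
Proof.
move=> hw; have uw : w \in unitmx.
  by have [] := mulmx1_unit (unitary_mulV hw).
by rewrite -[LHS]mul1mx -hw mulmxK.
Qed.

Lemma unitary_ctr n (w : 'M[C]_n) : unitary w -> unitary (ctr w).
Proof. by move=> hw; rewrite unitaryE ctrK unitary_mulV. Qed.

Lemma unitary_mul n (u w : 'M[C]_n) :
  unitary u -> unitary w -> unitary (u *m w).
Proof.
rewrite !unitaryE => hu hw.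
by rewrite ctrM mulmxA -[_ *m _ *m u]mulmxA hu mulmx1.
Qed.

Lemma hs_unitaryl n p (w : 'M[C]_n) (x y : 'M[C]_(n, p)) :
  unitary w -> hs (w *m x) (w *m y) = hs x y.
Proof.
move=> hw; rewrite -[X in hs (X *m _)]ctrK hs_mulml mulmxA [ctr w *m w]hw.
by rewrite mul1mx.
Qed.

Lemma hs_unitaryr n p (w : 'M[C]_n) (x y : 'M[C]_(p, n)) :
  unitary w -> hs (x *m w) (y *m w) = hs x y.
Proof.
move=> hw; rewrite -[X in hs (x *m X)]ctrK hs_mulmr -mulmxA unitary_mulV //.
by rewrite mulmx1.
Qed.

Lemma vnormE n (v : 'cV[C]_n) : vnorm v = Num.sqrt (hs v v).
Proof.
rewrite /vnorm hsE; congr Num.sqrt; apply: eq_bigr => i _.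
by rewrite big_ord1 !expr2.
Qed.

Lemma vnorm_ge0 n (v : 'cV[C]_n) : 0 <= vnorm v.
Proof. exact: sqrtr_ge0. Qed.

Lemma sqr_vnorm n (v : 'cV[C]_n) : vnorm v ^+ 2 = hs v v.
Proof. by rewrite vnormE sqr_sqrtr // hs_ge0. Qed.

Lemma hs_CS_vnorm n (v w : 'cV[C]_n) : `|hs v w| <= vnorm v * vnorm w.
Proof.
rewrite -(ler_pXn2r (n := 2)) ?nnegrE ?mulr_ge0 ?vnorm_ge0 //.
by rewrite exprMn !sqr_vnorm real_normK ?num_real // hs_CS.
Qed.

(** A unitary matrix is normal, hence unitarily diagonalisable; the diagonal factor is then unitary
    itself, so its entries have modulus 1. *)
Lemma unitary_spectral n (w : 'M[C]_n) : unitary w -> exists u d,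
  [/\ unitary u, w = ctr u *m diag_mx d *m u &
      forall j, complex.Re (d 0 j) ^+ 2 + complex.Im (d 0 j) ^+ 2 = 1].
Proof.
move=> hw; have wN : w \is normalmx.
  apply/normalmxP; by rewrite -map_trmx -/(ctr w) unitary_mulV.
have /orthomx_spectralP := wN.
have /unitarymxP := spectral_unitarymx w.
have := invmx_unitary (spectral_unitarymx w).
set u := spectralmx w; set d := spectral_diag w => ->.
rewrite -map_trmx -/(ctr u) => hu we.
have uu : unitary u by exact: mulmx1C.
exists u, d; split=> // j.
have dE : diag_mx d = u *m w *m ctr u.
  by rewrite we !mulmxA hu mul1mx -mulmxA hu mulmx1.
have : unitary (diag_mx d).
  by rewrite dE; do 2 ?apply: unitary_mul => //; exact: unitary_ctr.
rewrite unitaryE ctr_diag mulmx_diag => /matrixP /(_ j j).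
by rewrite !mxE eqxx !mulr1n => /(congr1 (@complex.Re R));
  rewrite ReM Re_conj Im_conj /= mulNr opprK -!expr2.
Qed.

End HilbertSchmidt.
Arguments ctr {R m p} x.
Arguments hs {R m p} x y.

(** * Comparison of the operator norm with the Hilbert-Schmidt norm *)

Section OperatorNorm.
Variables (R : realType) (n : nat).
Local Notation C := R[i].
Implicit Types (x : 'M[C]_n) (v : 'cV[C]_n).

(** Cauchy-Schwarz between x and the rank-one update x v v^*, whose squared norm is |v|^2 |x v|^2;
    one factor |x v|^2 cancels. *)
Lemma hs_mulv x v : hs (x *m v) (x *m v) <= hs x x * hs v v.
Proof.
have [->|xv0] := eqVneq (x *m v) 0.
  have -> : hs (0 : 'cV[C]_n) 0 = 0 by rewrite /hs mulmx0 raddf0.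
  by rewrite mulr_ge0 ?hs_ge0.
have p0 := hs_gt0 xv0.
have vv : ctr v *m v = ((hs v v)%:C%C)%:M.
  rewrite [LHS]mx11_scalar; congr (_ %:M); rewrite /hs /mxtrace big_ord1.
  rewrite -[LHS]RRe_real //; rewrite !mxE rpred_sum // => i _.
  by rewrite !mxE mulrC -normCK rpredX // normr_real.
have h1 : hs (x *m v) (x *m v) = hs x (x *m v *m ctr v).
  by rewrite -[in RHS]hs_mulmr ctrK.
have h2 : hs (x *m v *m ctr v) (x *m v *m ctr v) =
    hs v v * hs (x *m v) (x *m v).
  by rewrite hs_mulmr -mulmxA vv mul_mx_scalar hsZr.
have := hs_CS x (x *m v *m ctr v).
by rewrite h2 -h1 expr2 mulrA ler_pM2r.
Qed.

(** Boundedness is what makes the [sup] in [opnorm] an actual least upper bound. *)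
Lemma opnorm_has_sup x :
  has_sup [set vnorm (x *m v) | v in [set v : 'cV[C]_n | vnorm v <= 1]].
Proof.
split.
  exists (vnorm (x *m 0)), 0 => //=.
  by rewrite vnormE /hs mulmx0 raddf0 /= sqrtr0 ler01.
exists (Num.sqrt (hs x x)) => _ [v /= v1 <-].
rewrite vnormE ler_sqrt ?hs_ge0 // (le_trans (hs_mulv x v)) //.
rewrite -[leRHS]mulr1 ler_wpM2l ?hs_ge0 // -sqr_vnorm.
by rewrite expr_le1 ?vnorm_ge0.
Qed.

Lemma vnorm_le_opnorm x v : vnorm v <= 1 -> vnorm (x *m v) <= opnorm x.
Proof. by move=> v1; apply: (sup_upper_bound (opnorm_has_sup x)); exists v. Qed.

Lemma opnorm_ge0 x : 0 <= opnorm x.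
Proof.
apply: le_trans (vnorm_ge0 (x *m 0)) (vnorm_le_opnorm _ _).
by rewrite vnormE /hs mulmx0 raddf0 /= sqrtr0 ler01.
Qed.

Lemma opnorm_le x (a : R) : 0 <= a ->
  (forall v, hs (x *m v) (x *m v) <= a ^+ 2 * hs v v) -> opnorm x <= a.
Proof.
move=> a0 h; apply: ge_sup; first by case: (opnorm_has_sup x).
move=> _ [v /= v1 <-]; rewrite -(ler_pXn2r (n := 2)) ?nnegrE ?vnorm_ge0 //.
rewrite sqr_vnorm (le_trans (h v)) // -[leRHS]mulr1 ler_wpM2l ?sqr_ge0 //.
by rewrite -sqr_vnorm expr_le1 ?vnorm_ge0.
Qed.

End OperatorNorm.

(** * Monotonicity of integrals of nonnegative functions *)

Section Integral.
Local Open Scope ereal_scope.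

(* No measurability is needed: the integral of a nonnegative function is a
   supremum over the simple functions below it. *)
Lemma ge0_subset_le_integral d (T : measurableType d) (R : realType)
    (mu : {measure set T -> \bar R}) (D E : set T) (f g : T -> \bar R) :
  D `<=` E -> (forall x, D x -> 0 <= f x <= g x) ->
  (forall x, E x -> 0 <= g x) ->
  \int[mu]_(x in D) f x <= \int[mu]_(x in E) g x.
Proof.
move=> DE fg g0; rewrite ge0_integralE; last by move=> x /fg /andP[].
rewrite ge0_integralE //; apply: le_ereal_sup => _ [h hf <-]; exists h => //= x.
apply: le_trans (hf x) _; rewrite !patchE.
case: ifPn => [/set_mem Dx|_]; last by case: ifPn => // /set_mem /g0.
by rewrite mem_set; [case/andP: (fg _ Dx)|exact: DE].
Qed.

End Integral.

(** * Variation of an angle along a curve *)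

Section ArcCosine.
Variable R : realType.
Local Notation mu := (@lebesgue_measure R).

(** The factor l < 1 keeps the argument of [acos] inside ]-1, 1[, where it is differentiable. The
    derivative of acos (l f) is bounded by |f'| / sqrt (1 - f^2) whenever |f| < 1, and in general by
    L, because sqrt (1 - f^2) <= sqrt (1 - l^2 f^2). *)
Lemma acos_variation (f L : R -> R) (s t l : R) : s < t -> 0 < l < 1 ->
  (forall x, derivable f x 1) -> continuous (derive1 f) ->
  (forall x, s <= x <= t -> `|f x| <= 1) ->
  (forall x, 0 <= L x) ->
  (forall x, s < x < t -> `|(derive1 f) x| <= L x * Num.sqrt (1 - f x ^+ 2)) ->
  ((acos (l * f t) - acos (l * f s))%:E <=
     \int[mu]_(x in `[s, t]) (L x)%:E)%E.
Proof.
move=> st /andP[l0 l1] df cf f1 L0 fL.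
pose F x := acos (l * f x).
pose G x := - (Num.sqrt (1 - (l * f x) ^+ 2))^-1 * (l * (derive1 f) x).
have lf x : s <= x <= t -> `|l * f x| < 1.
  move=> /f1 fx; rewrite normrM gtr0_norm //.
  by rewrite (le_lt_trans (ler_wpM2l (ltW l0) fx)) // mulr1.
have lf1 x : s <= x <= t -> 0 < 1 - (l * f x) ^+ 2.
  by move=> /lf fx; rewrite subr_gt0 -real_normK ?num_real // expr_lt1.
have dF x : s <= x <= t -> is_derive x 1 F (G x).
  move=> xst; apply: is_derive1_comp.
    by apply: is_derive1_acos; rewrite -ltr_norml lf.
  have h : is_derive x 1 f ((derive1 f) x).
    by rewrite derive1E; apply: derivableP; exact: df.
  exact: (is_deriveZ l h).
have cF x : s <= x <= t -> {for x, continuous F}.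
  move=> xst; apply: differentiable_continuous; apply/derivable1_diffP.
  by have := dF _ xst; case.
have cff x : {for x, continuous f}.
  by apply: differentiable_continuous; apply/derivable1_diffP; exact: df.
have cG : {within `[s, t], continuous G}.
  apply: continuous_in_subspaceT => x; rewrite inE /= in_itv /= => xst.
  have h : {for x, continuous (fun x => l * f x)} by apply: cvgMr; exact: cff.
  apply: cvgM; last by apply: cvgMr; exact: cf.
  apply: cvgN; apply: cvgV; first by rewrite gt_eqF // sqrtr_gt0 lf1.
  apply: (@cvg_comp _ _ _ (fun x => 1 - (l * f x) ^+ 2) Num.sqrt).
    apply: cvgB; first exact: cvg_cst.
    exact: (cvgM (f := fun x => l * f x) (g := fun x => l * f x) h h).
  exact: sqrt_continuous.
have mG : measurable_fun `[s, t] G.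
  exact: subspace_continuous_measurable_fun.
have FTC : (\int[mu]_(x in `[s, t]) (G x)%:E = (F t)%:E - (F s)%:E)%E.
  apply: continuous_FTC2 => //.
    split.
    - move=> x; rewrite in_itv /= => /andP[/ltW sx /ltW xt].
      by have := dF x; rewrite sx xt => /(_ isT); case.
    - by apply: cvg_at_right_filter; apply: cF; rewrite lexx ltW.
    - by apply: cvg_at_left_filter; apply: cF; rewrite lexx ltW.
  move=> x; rewrite in_itv /= => /andP[/ltW sx /ltW xt].
  by rewrite derive1E; have := dF x; rewrite sx xt => /(_ isT); case.
rewrite EFinB -FTC; apply: le_trans (lee_abs _) _.
apply: le_trans (le_abse_integral _ _ _) _ => //.
  exact/measurable_EFinP.
(* The endpoints are dropped because the bound on f' is assumed at interior points only. *)
rewrite [leLHS](integral_itv_bndoo true false) /=; last first.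
  apply: (@measurable_funS _ _ _ _ `[s, t]) => //.
    by move=> z; exact: subset_itv_oo_cc.
  by apply/measurable_EFinP; apply: measurableT_comp => //;
    exact: normr_measurable.
apply: ge0_subset_le_integral.
- by move=> z; exact: subset_itv_oo_cc.
- move=> x /=; rewrite in_itv /= => /andP[sx xt]; rewrite !lee_fin normr_ge0 /=.
  have xst : s <= x <= t by rewrite !ltW.
  have := fL x; rewrite sx xt => /(_ isT) fx.
  rewrite /G normrM normrN normfV (ger0_norm (sqrtr_ge0 _)) normrM gtr0_norm //.
  rewrite mulrC ler_pdivrMr ?sqrtr_gt0 ?lf1 //.
  apply: le_trans (_ : 1 * `|(derive1 f) x| <= _).
    by rewrite ler_wpM2r // ltW.
  rewrite mul1r (le_trans fx) // ler_wpM2l // ler_sqrt; last exact/ltW/lf1.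
  rewrite lerD2l lerN2 exprMn -[leRHS]mul1r ler_wpM2r ?sqr_ge0 //.
  by rewrite expr_le1 ?ltW.
- by move=> x _; rewrite lee_fin.
Qed.

End ArcCosine.

(** * Length of unitary curves against angles on the sphere *)

Section Curves.
Variables (R : realType) (n : nat).
Local Notation C := R[i].
Local Notation mu := (@lebesgue_measure R).
Implicit Types (b : R -> 'M[C]_n).

Lemma smooth_dcurve b : smooth_curve b -> smooth_curve (dcurve b).
Proof.
move=> sb i j; have [s1 s2] := sb i j; split=> k t.
  have -> : (fun t => complex.Re (dcurve b t i j)) =
            derive1 (fun t => complex.Re (b t i j)).
    by apply/funext => u; rewrite mxE.
  by rewrite -iterSr; exact: s1.
have -> : (fun t => complex.Im (dcurve b t i j)) =
          derive1 (fun t => complex.Im (b t i j)).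
  by apply/funext => u; rewrite mxE.
by rewrite -iterSr; exact: s2.
Qed.

Lemma is_derive_hs c b (x : R) : smooth_curve b ->
  is_derive x 1 (fun t => hs c (b t)) (hs c (dcurve b x)).
Proof.
move=> sb.
have -> : (fun t => hs c (b t)) = \sum_(i < n) \sum_(j < n)
    ((complex.Re (c i j) \*: (fun t => complex.Re (b t i j)) : R -> R)
     + complex.Im (c i j) \*: (fun t => complex.Im (b t i j))).
  apply/funext => t; rewrite hsE fct_sumE; apply: eq_bigr => i _.
  by rewrite fct_sumE; apply: eq_bigr.
rewrite hsE; apply: is_derive_sum => i; apply: is_derive_sum => j.
have [s1 s2] := sb i j.
rewrite mxE /=; apply: is_deriveD; apply: is_deriveZ; rewrite derive1E.
  by apply: derivableP; exact: (s1 0%N).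
by apply: derivableP; exact: (s2 0%N).
Qed.

Lemma derive1_hs c b : smooth_curve b ->
  derive1 (fun t => hs c (b t)) = (fun t => hs c (dcurve b t)).
Proof.
move=> sb; apply/funext => t; rewrite derive1E.
by have := is_derive_hs c t sb; case.
Qed.

Lemma continuous_hs c b : smooth_curve b -> continuous (fun t => hs c (b t)).
Proof.
move=> sb x; apply: differentiable_continuous; apply/derivable1_diffP.
by have := is_derive_hs c x sb; case.
Qed.

Lemma dcurve_orthogonal b (s t x : R) (v : 'cV[C]_n) : smooth_curve b ->
  (forall x, s <= x <= t -> unitary (b x)) -> s < x < t ->
  hs (b x *m v) (dcurve b x *m v) = 0.
Proof.
move=> sb ub /andP[sx xt].
have bv y : s <= y <= t -> hs (b y *m v) (b y *m v) = hs v v.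
  by move=> /ub uy; exact: hs_unitaryl.
(* With this rank-one matrix, y |-> Re <b(x) v, y v> becomes [hs c y], to which [is_derive_hs]
   applies. *)
pose c := b x *m v *m ctr v.
have hc y : hs c y = hs (b x *m v) (y *m v) by rewrite /c hs_mulmr.
have xst : s <= x <= t by rewrite !ltW.
(* y |-> Re <b(x) v, b(y) v> is maximal at y = x by Cauchy-Schwarz. *)
have : is_derive x 1 (fun t => hs c (b t)) 0.
  apply: (@derive1_at_max _ _ s t).
  - by rewrite (ltW (lt_trans sx xt)).
  - by move=> y _; have := is_derive_hs c y sb; case.
  - by rewrite in_itv /= sx xt.
  - move=> y; rewrite in_itv /= => /andP[/ltW sy /ltW yt].
    rewrite !hc (bv x) //.
    have := hs_CS (b x *m v) (b y *m v).
    rewrite (bv x) // bv ?sy // -expr2 => h.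
    rewrite (le_trans (ler_norm _)) // -(ler_pXn2r (n := 2)) ?nnegrE ?hs_ge0 //.
    by rewrite real_normK ?num_real.
move=> [_ h0]; rewrite -hc; have [_ h1] := is_derive_hs c x sb.
by rewrite -h1 h0.
Qed.

(** The velocity is orthogonal to b(x) v, so w may be replaced by its component orthogonal to b(x)
    v, of norm sqrt (1 - f^2). *)
Lemma angle_derivative_le b (s t x : R) (v w : 'cV[C]_n) : smooth_curve b ->
  (forall x, s <= x <= t -> unitary (b x)) -> s < x < t ->
  hs v v = 1 -> hs w w = 1 ->
  `|hs w (dcurve b x *m v)| <=
    opnorm (dcurve b x) * Num.sqrt (1 - hs w (b x *m v) ^+ 2).
Proof.
move=> sb ub xst v1 w1.
have o := dcurve_orthogonal v sb ub xst.
set f := hs w (b x *m v).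
have -> : hs w (dcurve b x *m v) =
          hs (w - f%:C%C *: (b x *m v)) (dcurve b x *m v).
  by rewrite hsDl hsNl hsZl o mulr0 subr0.
apply: le_trans (hs_CS_vnorm _ _) _; rewrite mulrC ler_pM ?vnorm_ge0 //.
  by apply: vnorm_le_opnorm; rewrite vnormE v1 sqrtr1.
rewrite vnormE ler_sqrt; last first.
  rewrite subr_ge0 (le_trans (hs_CS _ _)) // w1 mul1r hs_unitaryl ?v1 //.
  by apply: ub; move/andP: xst => [/ltW -> /ltW ->].
rewrite hs_sqB w1 hsZr hsZl hsZr hs_unitaryl ?v1 -/f; last first.
  by apply: ub; move/andP: xst => [/ltW -> /ltW ->].
lra.
Qed.

(** The angle between u v and a(t) v, damped by l, starts at acos l; its increments over the pieces
    telescope, and each is at most the length of its piece. *)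
Lemma acos_pw_length u w a k ts bs (v : 'cV[C]_n) (l : R) :
  pw_path [set x : 'M[C]_n | unitary x] u w a k ts bs ->
  hs v v = 1 -> 0 < l < 1 ->
  ((acos (l * hs (u *m v) (w *m v)) - acos l)%:E <= pw_length k ts bs)%E.
Proof.
move=> [[k0 t0 t1 tS] [a0 a1] aU ab] v1 l01.
have uU : unitary u by rewrite -a0; apply: aU; rewrite lexx ler01.
pose F t := acos (l * hs (u *m v) (a t *m v)).
have -> : acos (l * hs (u *m v) (w *m v)) - acos l =
          \sum_(i < k) (F (ts i.+1) - F (ts i)).
  rewrite -(big_mkord xpredT (fun i => F (ts i.+1) - F (ts i))).
  rewrite telescope_sumr // t0 t1 /F a0 a1 hs_unitaryl // v1 mulr1 //.
have tmono i j : (i <= j <= k)%N -> ts i <= ts j.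
  move=> /andP[]; elim: j => [|j IH]; first by rewrite leqn0 => /eqP->.
  rewrite leq_eqVlt => /predU1P[->//|ij] jk.
  exact: le_trans (IH ij (ltnW jk)) (ltW (tS _ jk)).
rewrite -sumEFin; apply: lee_sum => i _.
have ik := ltn_ord i; have [sb abi] := ab _ ik.
have ti := tS _ ik.
have ub x : ts i <= x <= ts i.+1 -> unitary (bs i x).
  move=> xi; rewrite -abi //; apply: aU; case/andP: xi => x1 x2.
  rewrite -t0 -t1 (le_trans _ x1) ?tmono ?(ltnW ik) //=.
  by rewrite (le_trans x2) // tmono // ik leqnn.
pose c := u *m v *m ctr v.
have hc y : hs c y = hs (u *m v) (y *m v) by rewrite /c hs_mulmr.
rewrite /F !abi ?lexx ?(ltW ti) // -!hc.
apply: (acos_variation (f := fun t => hs c (bs i t))) => //.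
- by move=> x; have := is_derive_hs c x sb; case.
- rewrite derive1_hs //; apply: continuous_hs; exact: smooth_dcurve.
- move=> x xi; rewrite hc (le_trans (hs_CS_vnorm _ _)) // !vnormE.
  by rewrite !hs_unitaryl ?v1 ?sqrtr1 ?mulr1 //; exact: ub.
- by move=> x; exact: opnorm_ge0.
- move=> x xi; rewrite derive1_hs // !hc.
  apply: angle_derivative_le ub _ _ _ => //.
  by rewrite hs_unitaryl.
Qed.

(** The gap between r and r' pays twice: half of it for a path that only nearly attains the infimum,
    half for the damping factor in [acos_pw_length]. *)
Lemma dinf_le_angle (c a : 'M[C]_n) (r r' : R) :
  (dinf c a <= r%:E)%E -> r < r' -> r' < pi / 2 ->
  forall v : 'cV[C]_n, cos r' * hs v v <= hs (c *m v) (a *m v).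
Proof.
move=> ca rr' r'pi v.
have : (dinf c a < ((r + r') / 2)%:E)%E.
  by rewrite (le_lt_trans ca) // lte_fin; lra.
rewrite /dinf => /ereal_inf_lt [_ [al [k [ts [bs [pth ->]]]]] Lr].
have L0 : (0 <= pw_length k ts bs)%E.
  apply: sume_ge0 => i _; apply: integral_ge0 => x _.
  by rewrite lee_fin opnorm_ge0.
(* Positivity gives - r' < r, which is what keeps the angle e below pi / 2 and r' positive. *)
have r0 : 0 < (r + r') / 2 by rewrite -lte_fin (le_lt_trans L0).
have [->|v0] := eqVneq v 0.
  by rewrite !mulmx0 /hs mulmx0 raddf0 /= mulr0.
have v1 := hs_gt0 v0.
suff key (w : 'cV[C]_n) : hs w w = 1 -> cos r' <= hs (c *m w) (a *m w).
  pose q := (vnorm v)^-1.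
  have vn : vnorm v != 0.
    by rewrite -sqrf_eq0 sqr_vnorm gt_eqF.
  have q2 : q * q * hs v v = 1.
    by rewrite -sqr_vnorm /q -expr2 -exprMn mulVf // expr1n.
  have := key (q%:C%C *: v).
  rewrite -!scalemxAr !hsZl !hsZr !mulrA q2 => /(_ erefl) h.
  have -> : hs (c *m v) (a *m v) = hs v v * (q * q * hs (c *m v) (a *m v)).
    by rewrite mulrA [hs v v * _]mulrC q2 mul1r.
  by rewrite [leLHS]mulrC ler_pM2l.
move=> w1; set f := hs _ _.
have p2 := pi_gt0 R.
(* Taking l = cos e makes acos l = e, and (r + r') / 2 + e = r'. *)
pose e := (r' - r) / 2.
have e0 : 0 < e by rewrite divr_gt0 // subr_gt0.
have epi : e < pi / 2 by rewrite /e; lra.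
have le0 : 0 < cos e by apply: cos_gt0_pihalf; rewrite epi andbT; lra.
have le1 : cos e < 1.
  by rewrite -cos0 ltr_cos ?in_itv /= ?lexx ?ltW //; lra.
have := acos_pw_length (l := cos e) pth w1; rewrite le0 le1 => /(_ isT).
move=> /le_lt_trans /(_ Lr); rewrite lte_fin -/f.
rewrite cosK; last by rewrite in_itv /= ltW //=; lra.
have r'0 : 0 < r' by lra.
have cr' : 0 < cos r' by apply: cos_gt0_pihalf; rewrite r'pi andbT; lra.
have f1 : `|f| <= 1.
  have uc : unitary c.
    case: pth => [[_ t0 _ _] [<- _] h _]; apply: h; by rewrite lexx ler01.
  have ua : unitary a.
    case: pth => [[_ t0 _ _] [_ <-] h _]; apply: h; by rewrite lexx ler01.
  rewrite (le_trans (hs_CS_vnorm _ _)) // !vnormE.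
  by rewrite !hs_unitaryl ?w1 ?sqrtr1 ?mulr1.
have lf1 : -1 <= cos e * f <= 1.
  rewrite -ler_norml normrM gtr0_norm //.
  by have := ler_wpM2l (ltW le0) f1; rewrite mulr1; lra.
move=> h; have {}h : acos (cos e * f) < r' by rewrite /e in h *; lra.
have h2 : cos r' < cos e * f.
  rewrite -[X in _ < X]acosK; last by rewrite in_itv.
  by rewrite ltr_cos ?in_itv /= ?acos_ge0 ?acos_lepi //; rewrite ltW //=; lra.
(* Since f is positive, removing the factor cos e <= 1 only increases the right-hand side. *)
have f0 : 0 < f by rewrite -(pmulr_rgt0 _ le0) (lt_trans cr').
by rewrite (le_trans (ltW h2)) // -[leRHS]mul1r ler_wpM2r // ltW.
Qed.

End Curves.

(** * Unitary matrices as exponentials, and the length of the rotations they generate *)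

Section Rotations.
Variables (R : realType) (n : nat).
Local Notation C := R[i].

Definition cis (x : R) : C := Complex (cos x) (sin x).

Lemma cisD x y : cis (x + y) = cis x * cis y.
Proof.
by apply: complex_ext; rewrite ?ReM ?ImM /= ?cosD ?sinD // addrC; congr (_ + _);
  rewrite mulrC.
Qed.

Lemma conj_cis x : Num.conj (cis x) = cis (- x).
Proof. by rewrite /cis cosN sinN. Qed.

Lemma imag_even_pow (x : R) k :
  (Complex 0 x) ^+ k.*2 = ((-1) ^+ k * x ^+ k.*2)%:C%C.
Proof.
elim: k => [|k IH]; first by rewrite !expr0 mulr1.
rewrite doubleS !exprS IH; apply: complex_ext; rewrite !(ReM, ImM) /=; ring.
Qed.

(** Termwise Euler formula: the exponential series at i x splits into the series defining [cos] and
    [sin]. *)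
Lemma Re_imag_pow (x : R) k :
  complex.Re ((Complex 0 x) ^+ k / k`!%:R) = cos_coeff x k.
Proof.
have -> : (k`!%:R : C)^-1 = ((k`!%:R)^-1 : R)%:C%C.
  by rewrite fmorphV rmorph_nat.
rewrite mulrC Re_realM mulrC /cos_coeff /= -exprnP; congr (_ / _).
rewrite -{1}(odd_double_half k); case: (boolP (odd k)) => ko /=.
  by rewrite add1n exprS imag_even_pow mulrC Re_realM /= mulr0 !mul0r.
rewrite add0n imag_even_pow /= mul1r; congr (_ * x ^+ _).
by rewrite -{2}(odd_double_half k) (negbTE ko).
Qed.

Lemma Im_imag_pow (x : R) k :
  complex.Im ((Complex 0 x) ^+ k / k`!%:R) = sin_coeff x k.
Proof.
have -> : (k`!%:R : C)^-1 = ((k`!%:R)^-1 : R)%:C%C.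
  by rewrite fmorphV rmorph_nat.
rewrite mulrC Im_realM mulrC /sin_coeff /=; congr (_ / _).
rewrite -{1}(odd_double_half k); case: (boolP (odd k)) => ko /=; last first.
  by rewrite add0n imag_even_pow /= !mul0r.
rewrite add1n exprS imag_even_pow mulrC Im_realM /= mul1r -mulrA -exprSr.
have kE : k = (k./2).*2.+1 by rewrite -{1}(odd_double_half k) ko add1n.
by rewrite -kE {3}kE /= doubleK.
Qed.

Definition imag_exp (x : R) N : C := \sum_(k < N) (Complex 0 x) ^+ k / k`!%:R.

Lemma cvg_Re_imag_exp x : (complex.Re (imag_exp x N) @[N --> \oo]) --> cos x.
Proof.
have h : series (cos_coeff x) @ \oo --> cos x.
  by rewrite cos.unlock; exact: is_cvg_series_cos_coeff.
apply: cvg_trans h.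
apply: near_eq_cvg; near=> N; rewrite /series /= /imag_exp Re_sum big_mkord.
by apply: eq_bigr => k _; rewrite -Re_imag_pow.
Unshelve. all: by end_near. Qed.

Lemma cvg_Im_imag_exp x : (complex.Im (imag_exp x N) @[N --> \oo]) --> sin x.
Proof.
have h : series (sin_coeff x) @ \oo --> sin x.
  by rewrite sin.unlock; exact: is_cvg_series_sin_coeff.
apply: cvg_trans h.
apply: near_eq_cvg; near=> N; rewrite /series /= /imag_exp Im_sum big_mkord.
by apply: eq_bigr => k _; rewrite -Im_imag_pow.
Unshelve. all: by end_near. Qed.

Lemma cvg_sumr (I : Type) (r : seq I) (f : I -> R ^nat) (l : I -> R) :
  (forall i, f i N @[N --> \oo] --> l i) ->
  (\sum_(i <- r) f i N @[N --> \oo]) --> \sum_(i <- r) l i.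
Proof.
move=> fl; elim: r => [|i r IH].
  by rewrite big_nil; under eq_cvg do rewrite big_nil; exact: cvg_cst.
by rewrite big_cons; under eq_cvg do rewrite big_cons; exact: cvgD.
Qed.

(** Matrices diagonalised by a common pair p, q, with q usually inverse to p, so that products and
    exponentials act on eigenvalues. Keeping p and q separate also covers left translates g p
    diag(d) q. *)
Definition cdiag (p q : 'M[C]_n) (d : 'I_n -> C) : 'M[C]_n :=
  p *m diag_mx (\row_j d j) *m q.

Lemma cdiagE p q d i j : cdiag p q d i j = \sum_l p i l * q l j * d l.
Proof.
rewrite /cdiag mxE; apply: eq_bigr => l _; rewrite mul_mx_diag !mxE.
by rewrite mulrAC.
Qed.

Lemma cdiagM p q d p' q' d' : q *m p' = 1%:M ->
  cdiag p q d *m cdiag p' q' d' = cdiag p q' (fun l => d l * d' l).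
Proof.
move=> qp; rewrite /cdiag !mulmxA -[_ *m q *m p']mulmxA qp mulmx1.
rewrite -[p *m _ *m diag_mx _]mulmxA mulmx_diag; congr (_ *m diag_mx _ *m _).
by apply/rowP => j; rewrite !mxE.
Qed.

Lemma cdiag1 p q : p *m q = 1%:M -> cdiag p q (fun=> 1) = 1%:M.
Proof.
move=> pq; rewrite /cdiag (_ : \row_j 1 = const_mx 1) ?diag_const_mx ?mulmx1 //.
by apply/rowP => j; rewrite !mxE.
Qed.

Lemma cdiagZ p q d (a : C) : a *: cdiag p q d = cdiag p q (fun l => a * d l).
Proof.
rewrite /cdiag scalemxAl scalemxAr; congr (_ *m _ *m _).
by apply/matrixP => i j; rewrite !mxE mulrnAr.
Qed.

Lemma cdiag_ext p q d d' : d =1 d' -> cdiag p q d = cdiag p q d'.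
Proof.
by move=> dd; congr (_ *m diag_mx _ *m _); apply/rowP => j; rewrite !mxE dd.
Qed.

Lemma ctr_cdiag p q d :
  ctr (cdiag p q d) = cdiag (ctr q) (ctr p) (fun l => Num.conj (d l)).
Proof.
rewrite /cdiag !ctrM ctr_diag mulmxA; congr (_ *m diag_mx _ *m _).
by apply/rowP => j; rewrite !mxE.
Qed.

Lemma mul_cdiag g p q d : g *m cdiag p q d = cdiag (g *m p) q d.
Proof. by rewrite /cdiag !mulmxA. Qed.

Lemma cdiag_mxpow p q d k : p *m q = 1%:M ->
  mxpow (cdiag p q d) k = cdiag p q (fun l => d l ^+ k).
Proof.
move=> pq; elim: k => [|k IH].
  by rewrite /mxpow /= -[LHS](cdiag1 pq); apply: cdiag_ext => l; rewrite expr0.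
rewrite /mxpow iterS -/(mxpow _ _) IH cdiagM; last exact: mulmx1C.
by apply: cdiag_ext => l; rewrite exprS.
Qed.

Lemma expm_partial_cdiag p q d N : p *m q = 1%:M ->
  expm_partial (cdiag p q d) N =
  cdiag p q (fun l => \sum_(k < N) d l ^+ k / k`!%:R).
Proof.
move=> pq; apply/matrixP => i j; rewrite cdiagE /expm_partial summxE.
under eq_bigr do rewrite cdiag_mxpow // cdiagZ cdiagE.
rewrite exchange_big; apply: eq_bigr => l _; rewrite mulr_sumr.
by apply: eq_bigr => k _; rewrite [_^-1 * _]mulrC.
Qed.

(** Each entry is a fixed linear combination of the scalar series at i th l, so the entrywise limits
    in [expm] reduce to those of cosine and sine. *)
Lemma expm_imag p q (th : 'I_n -> R) : p *m q = 1%:M ->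
  expm (cdiag p q (fun l => Complex 0 (th l))) =
  cdiag p q (fun l => cis (th l)).
Proof.
move=> pq; apply/matrixP => i j; rewrite mxE; apply: complex_ext => /=.
  apply: cvg_lim; first exact: Rhausdorff.
  rewrite cdiagE Re_sum.
  under eq_fun do rewrite expm_partial_cdiag // cdiagE Re_sum.
  under eq_bigr do rewrite ReM.
  apply: cvg_sumr => l.
  under eq_fun do rewrite ReM.
  apply: cvgB; apply: cvgMr; [exact: cvg_Re_imag_exp|exact: cvg_Im_imag_exp].
apply: cvg_lim; first exact: Rhausdorff.
rewrite cdiagE Im_sum.
under eq_fun do rewrite expm_partial_cdiag // cdiagE Im_sum.
under eq_bigr do rewrite ImM.
apply: cvg_sumr => l.
under eq_fun do rewrite ImM.
apply: cvgD; apply: cvgMr; [exact: cvg_Im_imag_exp|exact: cvg_Re_imag_exp].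
Qed.

(** The shape of every real or imaginary part of an entry of a rotation. For fixed frequencies the
    family is closed under differentiation, which gives smoothness by induction on the order. *)
Definition trig_sum (A B th : 'I_n -> R) (t : R) : R :=
  \sum_l (A l * cos (t * th l) + B l * sin (t * th l)).

Lemma is_derive_trig_sum A B th (t : R) : is_derive t 1 (trig_sum A B th)
  (trig_sum (fun l => B l * th l) (fun l => - A l * th l) th t).
Proof.
have -> : trig_sum A B th = \sum_l ((A l \*: (fun t => cos (t * th l)) : R -> R)
   + B l \*: (fun t => sin (t * th l))).
  by apply/funext => u; rewrite fct_sumE.
apply: is_derive_sum => l.
have h : is_derive t (1 : R) (fun t : R => t * th l) (th l).
  by apply: is_derive_eq (is_deriveM _ _) _; rewrite scaler0 add0r [_%:A]mulr1.
have hc := is_derive1_comp (g := fun t => t * th l) (x := t)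
  (is_derive_cos (t * th l)) h.
have hs' := is_derive1_comp (g := fun t => t * th l) (x := t)
  (is_derive_sin (t * th l)) h.
apply: is_derive_eq (is_deriveD (is_deriveZ _ hc) (is_deriveZ _ hs')) _.
rewrite /GRing.scale /=; ring.
Qed.

Lemma smooth_trig_sum A B th : smooth_fun (trig_sum A B th).
Proof.
move=> k t.
have [A' [B' ->]] : exists A' B',
    iter k (@derive1 R R) (trig_sum A B th) = trig_sum A' B' th.
  elim: k => [|k [A' [B' IH]]]; first by exists A, B.
  exists (fun l => B' l * th l), (fun l => - A' l * th l); rewrite iterS IH.
  apply/funext => u; rewrite derive1E.
  by have := is_derive_trig_sum A' B' th u; case.
by have := is_derive_trig_sum A' B' th t; case.
Qed.

Lemma Re_rotation p q th i j :
  (fun t => complex.Re (cdiag p q (fun l => cis (t * th l)) i j)) =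
  trig_sum (fun l => complex.Re (p i l * q l j))
           (fun l => - complex.Im (p i l * q l j)) th.
Proof.
apply/funext => t; rewrite cdiagE Re_sum; apply: eq_bigr => l _.
by rewrite [LHS]ReM /= mulNr.
Qed.

Lemma Im_rotation p q th i j :
  (fun t => complex.Im (cdiag p q (fun l => cis (t * th l)) i j)) =
  trig_sum (fun l => complex.Im (p i l * q l j))
           (fun l => complex.Re (p i l * q l j)) th.
Proof.
apply/funext => t; rewrite cdiagE Im_sum; apply: eq_bigr => l _.
by rewrite [LHS]ImM /= addrC.
Qed.

Lemma smooth_rotation p q th :
  smooth_curve (fun t => cdiag p q (fun l => cis (t * th l))).
Proof.
by move=> i j; rewrite Re_rotation Im_rotation; split; exact: smooth_trig_sum.
Qed.

Lemma dcurve_rotation p q th t :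
  dcurve (fun t => cdiag p q (fun l => cis (t * th l))) t =
  cdiag p q (fun l => Complex 0 (th l) * cis (t * th l)).
Proof.
apply/matrixP => i j; rewrite mxE Re_rotation Im_rotation !derive1E cdiagE.
apply: complex_ext => /=.
  have [_ ->] := is_derive_trig_sum (fun l => complex.Re (p i l * q l j))
    (fun l => - complex.Im (p i l * q l j)) th t.
  rewrite Re_sum; apply: eq_bigr => l _; set z := _ * q l j.
  rewrite [RHS]ReM ReM ImM /=; ring.
have [_ ->] := is_derive_trig_sum (fun l => complex.Im (p i l * q l j))
  (fun l => complex.Re (p i l * q l j)) th t.
rewrite Im_sum; apply: eq_bigr => l _; set z := _ * q l j.
rewrite [RHS]ImM ReM ImM /=; ring.
Qed.

Lemma unitary_cdiag_cis p q th : unitary p -> unitary q ->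
  unitary (cdiag p q (fun l => cis (th l))).
Proof.
move=> up uq; rewrite unitaryE ctr_cdiag cdiagM //.
rewrite (cdiag_ext _ _ (d' := fun=> 1)) ?cdiag1 // => l.
by rewrite conj_cis -cisD addNr /cis cos0 sin0.
Qed.

Lemma opnorm_cdiag_le p q d (a : R) : unitary p -> unitary q -> 0 <= a ->
  (forall l, complex.Re (d l) ^+ 2 + complex.Im (d l) ^+ 2 <= a ^+ 2) ->
  opnorm (cdiag p q d) <= a.
Proof.
move=> up uq a0 da; apply: opnorm_le => // v.
rewrite /cdiag -!mulmxA hs_unitaryl // -[hs v v](hs_unitaryl v v uq).
rewrite !hsE mulr_sumr; apply: ler_sum => i _; rewrite !big_ord1.
move: (q *m v) => z; rewrite mul_diag_mx !mxE ReM ImM.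
set x := complex.Re (z _ _); set y := complex.Im (z _ _).
have := da i; set r := complex.Re _; set s := complex.Im _ => h.
have -> : (r * x - s * y) * (r * x - s * y) + (r * y + s * x) * (r * y + s * x)
  = (r ^+ 2 + s ^+ 2) * (x * x + y * y) by ring.
by rewrite ler_wpM2r // addr_ge0 // -expr2 sqr_ge0.
Qed.

(** The curve t |-> p diag(cis (t th)) q runs from p q to the target, and its velocity has
    eigenvalue factors of modulus |th l| <= a. *)
Lemma dinf_rotation p q (th : 'I_n -> R) (a : R) :
  unitary p -> unitary q -> 0 <= a -> (forall l, `|th l| <= a) ->
  (dinf (p *m q) (cdiag p q (fun l => cis (th l))) <= a%:E)%E.
Proof.
move=> up uq a0 tha.
pose b t := cdiag p q (fun l => cis (t * th l)).
apply: (@le_trans _ _ (pw_length 1 (fun i => i%:R) (fun=> b))).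
  apply: ereal_inf_lbound; exists b, 1%N, (fun i => i%:R), (fun=> b).
  split=> //.
  split.
  - by split=> // -[|i] //; rewrite ltr01.
  - split; last by apply: cdiag_ext => l; rewrite mul1r.
    rewrite /b /cdiag (_ : diag_mx _ = 1%:M) ?mulmx1 //.
    rewrite -diag_const_mx; congr diag_mx; apply/rowP => j.
    by rewrite !mxE mul0r /cis cos0 sin0.
  - by move=> t _; exact: unitary_cdiag_cis.
  - by move=> i _; split=> //; exact: smooth_rotation.
rewrite /pw_length big_ord1.
have -> : (a%:E = \int[@lebesgue_measure R]_(t in `[(0 : R)%R, 1%R]) a%:E)%E.
  rewrite integral_cst //= lebesgue_measure_itv /= lte_fin ltr01.
  by rewrite oppr0 adde0 mule1.
apply: ge0_subset_le_integral => // t _.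
rewrite !lee_fin opnorm_ge0 /= /b dcurve_rotation opnorm_cdiag_le // => l.
have -> : complex.Re (Complex 0 (th l) * cis (t * th l)) ^+ 2 +
  complex.Im (Complex 0 (th l) * cis (t * th l)) ^+ 2 =
  th l ^+ 2 * (cos (t * th l) ^+ 2 + sin (t * th l) ^+ 2).
  by rewrite ReM ImM /=; ring.
by rewrite cos2Dsin2 mulr1 -real_normK ?num_real // ler_pXn2r ?nnegrE.
Qed.

(** The argument is acos x, with the sign of y; excluding -1 makes it strictly smaller than pi in
    modulus. *)
Lemma argument_exists (z : C) : complex.Re z ^+ 2 + complex.Im z ^+ 2 = 1 ->
  z != -1 -> exists2 th : R, `|th| < pi & z = cis th.
Proof.
case: z => x y /= xy z1.
have x1 : -1 <= x <= 1.
  rewrite -ler_norml -(ler_pXn2r (n := 2)) ?nnegrE // expr1n.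
  by rewrite real_normK ?num_real // -xy lerDl sqr_ge0.
have xN1 : -1 < x.
  case/andP: x1 => x1 _; rewrite lt_neqAle x1 andbT.
  apply: contra z1 => /eqP x1'.
  rewrite -x1' in xy *; have /eqP : y ^+ 2 = 0 by lra.
  by rewrite sqrf_eq0 => /eqP ->; apply/eqP/complex_ext => /=; rewrite ?oppr0.
have sa : sin (acos x) = `|y|.
  by rewrite sin_acos // -sqrtr_sqr; congr Num.sqrt; lra.
have aB : `|acos x| < pi.
  by rewrite ger0_norm ?acos_ge0 // acos_ltpi // xN1; case/andP: x1.
have ca : cos (acos x) = x by apply: acosK; rewrite in_itv.
have [y0|y0] := leP 0 y.
  by exists (acos x) => //; rewrite /cis ca sa ger0_norm.
exists (- acos x); first by rewrite normrN.
by rewrite /cis cosN sinN ca sa ltr0_norm // opprK.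
Qed.

Lemma unitary_rotation (w : 'M[C]_n) : unitary w ->
  (forall v : 'cV[C]_n, w *m v = - v -> v = 0) ->
  exists u th a, [/\ unitary u, 0 <= a < pi, forall l, `|th l| <= a &
    w = cdiag (ctr u) u (fun l => cis (th l))].
Proof.
move=> uw wN; have [u [d [uu we d1]]] := unitary_spectral uw.
have wE : w = cdiag (ctr u) u (fun l => d 0 l).
  rewrite we /cdiag; congr (_ *m diag_mx _ *m _).
  by apply/rowP => j; rewrite mxE.
have dN l : d 0 l != -1.
  (* An eigenvalue -1 would have the eigenvector [ctr u *m e], which the hypothesis forces to
     vanish. *)
  apply/eqP => dl; pose e : 'cV[C]_n := delta_mx l 0.
  have := wN (ctr u *m e).
  have -> : w *m (ctr u *m e) = - (ctr u *m e).
    have -> : w *m (ctr u *m e) = ctr u *m (diag_mx d *m e).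
      by rewrite we mulmxA -(mulmxA _ u) unitary_mulV // mulmx1 mulmxA.
    rewrite -mulmxN; congr (_ *m _).
    apply/matrixP => i j; rewrite mul_diag_mx !mxE.
    by case: eqP => [->|_] /=; rewrite ?dl ?mulr0 ?oppr0 // mulN1r.
  move=> /(_ erefl) /(congr1 (mulmx u)).
  rewrite mulmxA unitary_mulV // mul1mx mulmx0 => /matrixP /(_ l 0).
  by rewrite !mxE !eqxx => /eqP; rewrite oner_eq0.
have /choice [th thP] : forall l, exists t : R, `|t| < pi /\ d 0 l = cis t.
  by move=> l; have [t t1 t2] := argument_exists (d1 l) (dN l); exists t.
(* A maximum of finitely many numbers below pi stays below pi; the base value 0 covers n = 0. *)
exists u, th, (\big[Num.max/0]_l `|th l|); split=> //.
- apply/andP; split; first exact: bigmax_ge_id.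
  by apply: bigmax_lt => [|l _]; [exact: pi_gt0|case: (thP l)].
- by move=> l; exact: le_bigmax.
- by rewrite wE; apply: cdiag_ext => l; case: (thP l).
Qed.

(** Provides the logarithm that [geodesic_subset] asks for. *)
Lemma is_log_rotation u (th : 'I_n -> R) (a : R) : unitary u -> 0 <= a < pi ->
  (forall l, `|th l| <= a) ->
  is_log (cdiag (ctr u) u (fun l => cis (th l)))
         (cdiag (ctr u) u (fun l => Complex 0 (th l))).
Proof.
move=> uu /andP[a0 api] tha; split; last split.
- rewrite /skew_herm [adj _]ctr_cdiag ctrK -scaleN1r cdiagZ.
  by apply: cdiag_ext => l; apply: complex_ext; rewrite ?ReM ?ImM /= ; ring.
- apply: le_lt_trans api; apply: opnorm_cdiag_le => //.
    exact: unitary_ctr.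
  move=> l /=; rewrite expr0n /= add0r.
  by rewrite -real_normK ?num_real // ler_pXn2r ?nnegrE.
- by rewrite expm_imag.
Qed.

End Rotations.

(** * Geodesic midpoints and uniform concavity of the trace functional *)

Section Midpoint.
Variables (R : realType) (n : nat).
Local Notation C := R[i].
Implicit Types (g a m : 'M[C]_n) (v : 'cV[C]_n).

Lemma sqr_entries_sum v :
  \sum_l (complex.Re (v l 0) ^+ 2 + complex.Im (v l 0) ^+ 2) = hs v v.
Proof. by rewrite hsE; apply: eq_bigr => l _; rewrite big_ord1 -!expr2. Qed.

Lemma hs_cdiag u z v (c : C) : unitary u ->
  hs (cdiag (ctr u) u z *m v) (c *: v) =
  \sum_l complex.Re (Num.conj (z l) * c) *
   (complex.Re ((u *m v) l 0) ^+ 2 + complex.Im ((u *m v) l 0) ^+ 2).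
Proof.
move=> uu; rewrite /cdiag -!mulmxA hs_mulml -scalemxAr; move: (u *m v) => x.
rewrite hsE; apply: eq_bigr => l _; rewrite big_ord1 mul_diag_mx !mxE.
rewrite !(ReM, ImM) Re_conj Im_conj; ring.
Qed.

(** Lets bounds that hold vector by vector be summed to a bound on the trace. *)
Lemma hs_cols (k p : nat) (x y : 'M[C]_(k, p)) :
  hs x y = \sum_l hs (x *m delta_mx l (0 : 'I_1)) (y *m delta_mx l 0).
Proof.
rewrite hsE exchange_big; apply: eq_bigr => l _; rewrite hsE.
apply: eq_bigr => i _; rewrite big_ord1 -!colE !mxE //.
Qed.

(** A substitute for a ball in the metric: the condition is linear in g, so it can be added for two
    group elements. *)
Definition within_angle (O : set 'M[C]_n) (kappa : R) g : Prop :=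
  forall a, O a -> forall v, kappa * hs v v <= hs (g *m v) (a *m v).

(** The eigenvalue form of g1 + g2 = m P, where P has eigenvalues 2 cos (th / 2). *)
Lemma half_angle (th : R) : cis (th / 2) * (2 * cos (th / 2))%:C%C = 1 + cis th.
Proof.
have hh : th = th / 2 + th / 2 by rewrite -splitr.
rewrite [in RHS]hh cisD; apply: complex_ext; rewrite !(ReM, ReD, ImM, ImD) /=.
  have := cos2Dsin2 (th / 2); set c := cos _; set s := sin _ => h.
  nra.
ring.
Qed.

Lemma cdiagD (p q : 'M[C]_n) d d' :
  cdiag p q d + cdiag p q d' = cdiag p q (fun l => d l + d' l).
Proof.
rewrite /cdiag -mulmxDl -mulmxDr -linearD; congr (_ *m diag_mx _ *m _).
by apply/rowP => j; rewrite !mxE.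
Qed.

Lemma cdiagN (p q : 'M[C]_n) d :
  - cdiag p q d = cdiag p q (fun l => - d l).
Proof. by rewrite -scaleN1r cdiagZ; apply: cdiag_ext => l; rewrite mulN1r. Qed.

(* With P = cdiag (ctr u) u (2 co), so that 0 <= P <= 2: an eigenvalue d of
   a^* m with unit eigenvector e satisfies
   2 kappa <= Re <a e, m P e> = Re d * <e, P e> <= 2 Re d. *)
Lemma within_angle_midpoint u (co : 'I_n -> R) a m (kappa : R) :
  unitary u -> unitary a -> unitary m ->
  (forall l, 0 <= co l <= 1) -> 0 < kappa ->
  (forall v, 2 * kappa * hs v v <=
     hs (m *m cdiag (ctr u) u (fun l => (2 * co l)%:C%C) *m v) (a *m v)) ->
  forall v, kappa * hs v v <= hs (m *m v) (a *m v).
Proof.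
move=> uu ua um co01 k0 hP.
have uV : unitary (ctr a *m m) by apply: unitary_mul => //; exact: unitary_ctr.
have [u' [d [uu' Ve d1]]] := unitary_spectral uV.
have VE : ctr a *m m = cdiag (ctr u') u' (fun l => d 0 l).
  rewrite Ve /cdiag; congr (_ *m diag_mx _ *m _).
  by apply/rowP => j; rewrite mxE.
suff dk l : kappa <= complex.Re (d 0 l).
  move=> v.
  have -> : hs (m *m v) (a *m v) = hs (ctr a *m m *m v) (1 *: v).
    by rewrite scale1r -mulmxA hs_mulml.
  rewrite VE hs_cdiag // -(hs_unitaryl v v uu') -sqr_entries_sum mulr_sumr.
  apply: ler_sum => l _; rewrite mulr1 Re_conj ler_wpM2r //.
  by rewrite addr_ge0 // sqr_ge0.
pose e : 'cV[C]_n := ctr u' *m delta_mx l 0.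
have ee : hs e e = 1.
  rewrite /e hs_unitaryl; last exact: unitary_ctr.
  rewrite -sqr_entries_sum (bigD1 l) //= big1 ?addr0.
    by rewrite mxE !eqxx /= expr0n addr0 expr1n.
  by move=> j jl; rewrite mxE (negbTE jl) /= expr0n addr0.
have Vee : ctr a *m m *m e = d 0 l *: e.
  rewrite Ve /e mulmxA -(mulmxA _ u') unitary_mulV // mulmx1 -mulmxA scalemxAr.
  congr (_ *m _); apply/matrixP => i j; rewrite mul_diag_mx !mxE.
  by case: eqP => [->|_] //=; rewrite !mulr0.
(* From m e = d a e and |d| = 1. *)
have ae : a *m e = Num.conj (d 0 l) *: (m *m e).
  have -> : m *m e = d 0 l *: (a *m e).
    by rewrite scalemxAr -Vee !mulmxA unitary_mulV // mul1mx.
  rewrite scalerA (_ : _ * _ = 1) ?scale1r //.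
  apply: complex_ext; rewrite ?ReM ?ImM Re_conj Im_conj /=.
    by rewrite -(d1 l); ring.
  ring.
have := hP e; rewrite ee mulr1 ae -mulmxA scalemxAr hs_unitaryl // hs_cdiag //.
set wt := fun j => complex.Re ((u *m e) j 0) ^+ 2
                   + complex.Im ((u *m e) j 0) ^+ 2.
have wt0 j : 0 <= wt j by rewrite addr_ge0 // sqr_ge0.
have wt1 : \sum_j wt j = 1 by rewrite sqr_entries_sum hs_unitaryl.
have -> : \sum_j complex.Re (Num.conj ((2 * co j)%:C%C)
                             * Num.conj (d 0 l)) * wt j =
          complex.Re (d 0 l) * (2 * \sum_j co j * wt j).
  rewrite mulrA mulr_sumr; apply: eq_bigr => j _.
  rewrite ReM !Re_conj !Im_conj /=; ring.
set s := \sum_j _; have s0 : 0 <= s.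
  by apply: sumr_ge0 => j _; rewrite mulr_ge0 //; case/andP: (co01 j).
have s1 : s <= 1.
  rewrite -wt1; apply: ler_sum => j _; rewrite -[leRHS]mul1r ler_wpM2r //.
  by case/andP: (co01 j).
set x := complex.Re _ => h.
have x0 : 0 < x.
  rewrite ltNge; apply/negP => x0.
  have : x * (2 * s) <= 0 by rewrite mulr_le0_ge0 // mulr_ge0.
  lra.
have : x * s <= x * 1 by rewrite ler_wpM2l // ltW.
lra.
Qed.

(** For c = cos (th / 2) the left side is 2 - 2 cos th, the squared chord; the two sides differ by 4
    (1 - c)^2. *)
Lemma sqr_chord_le (c : R) : 2 - 2 * (2 * c ^+ 2 - 1) <= 4 * (2 - 2 * c).
Proof.
have : 0 <= (1 - c) ^+ 2 by exact: sqr_ge0.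
rewrite (_ : (1 - c) ^+ 2 = 1 - 2 * c + c ^+ 2); last by ring.
lra.
Qed.

Lemma chord_bound_le (k x y z : R) : 0 < k -> x <= 4 * y -> k * y <= z ->
  k / 8 * x <= z / 2.
Proof.
move=> k0 xy kyz; have : k * x <= k * (4 * y) by rewrite ler_wpM2l // ltW.
lra.
Qed.

(** Write 2 m = m P + m (2 - P) with m P = g1 + g2. The first term gives the average of the two
    values. The second contributes at least kappa tr (2 - P) / 2, and 4 tr (2 - P) bounds |g1 -
    g2|^2. *)
Lemma geodesic_midpoint (G O : set 'M[C]_n) (kappa : R) g1 g2 :
  subgroup_Un G -> geodesic_subset G -> O `<=` G -> O !=set0 -> 0 < kappa ->
  G g1 -> G g2 -> within_angle O kappa g1 -> within_angle O kappa g2 ->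
  exists m, [/\ G m, within_angle O kappa m & forall a, O a ->
    (hs a g1 + hs a g2) / 2 + kappa / 8 * hs (g1 - g2) (g1 - g2) <= hs a m].
Proof.
move=> [GU _ _ _] [_ Ggeo] OG [a0 Oa0] k0 G1 G2 w1 w2.
have u1 := GU _ G1; have u2 := GU _ G2.
have uw : unitary (ctr g1 *m g2).
  by apply: unitary_mul => //; exact: unitary_ctr.
(* Such a v satisfies g2 v = - g1 v, whereas g1 v and g2 v both have positive product with a0 v
   unless v = 0. *)
have noN1 v : ctr g1 *m g2 *m v = - v -> v = 0.
  move=> /(congr1 (mulmx g1)); rewrite !mulmxA unitary_mulV //.
  rewrite mul1mx mulmxN => hv.
  apply/eqP/negP => /negP v0; have vv := hs_gt0 v0.
  have := w1 _ Oa0 v; have := w2 _ Oa0 v; rewrite hv hsNl.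
  have : 0 < kappa * hs v v by rewrite mulr_gt0.
  lra.
have [u [th [b [uu b01 thb wE]]]] := unitary_rotation uw noN1.
have ucu := unitary_ctr uu.
have g2E : g2 = g1 *m cdiag (ctr u) u (fun l => cis (th l)).
  by rewrite -wE mulmxA unitary_mulV // mul1mx.
have d12 : (dinf g1 g2 < pi%:E)%E.
  have up : unitary (g1 *m ctr u) by exact: unitary_mul.
  case/andP: b01 => b0 bpi.
  have := dinf_rotation up uu b0 thb.
  rewrite -mulmxA [ctr u *m u]uu mulmx1 -mul_cdiag -g2E => /le_lt_trans; apply.
  by rewrite lte_fin.
have := Ggeo _ _ G1 G2 d12.
rewrite unitary_invmx // wE => /(_ _ (is_log_rotation uu b01 thb)).
have half01 : 0 <= (2^-1 : R) <= 1.
  by apply/andP; split; lra.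
move=> /(_ _ half01); rewrite cdiagZ.
rewrite (cdiag_ext (ctr u) u (d' := fun l => Complex 0 (th l / 2))); last first.
  by move=> l; apply: complex_ext; rewrite !(ReM, ImM) /=; ring.
rewrite expm_imag // => Gm.
set D := cdiag (ctr u) u (fun l => cis (th l / 2)) in Gm.
exists (g1 *m D).
have um := GU _ Gm.
pose co l := cos (th l / 2).
(* Here |th l| / 2 < pi / 2, so the cosine is nonnegative. *)
have co01 l : 0 <= co l <= 1.
  rewrite cos_le1 andbT; apply: cos_ge0_pihalf.
  rewrite -ler_norml normrM [`|2^-1|]gtr0_norm ?invr_gt0 //.
  by rewrite ler_pM2r ?invr_gt0 //; case/andP: b01 => _ /ltW; apply: le_trans.
have sumE : g1 + g2 = g1 *m D *m cdiag (ctr u) u (fun l => (2 * co l)%:C%C).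
  rewrite -mulmxA cdiagM; last exact: unitary_mulV.
  have -> : g1 + g2 = g1 *m (1%:M + cdiag (ctr u) u (fun l => cis (th l))).
    by rewrite mulmxDr mulmx1 -g2E.
  rewrite -(cdiag1 (p := ctr u) (q := u) uu).
  by rewrite cdiagD; congr (_ *m _); apply: cdiag_ext => l; rewrite half_angle.
have wm : within_angle O kappa (g1 *m D).
  move=> a Oa; have ua := GU _ (OG _ Oa).
  apply: (within_angle_midpoint uu ua um co01 k0) => v.
  rewrite -sumE mulmxDl hsDl.
  by rewrite -mulrA [2 * _]mulr_natl mulr2n lerD //; [exact: w1|exact: w2].
split=> // a Oa; have ua := GU _ (OG _ Oa).
rewrite -hsDr sumE.
(* The eigenvalues of 2 - P. *)
pose q l := 2 - 2 * co l.
have qE : hs a (g1 *m D) =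
  (hs a (g1 *m D *m cdiag (ctr u) u (fun l => (2 * co l)%:C%C)) +
   hs a (g1 *m D *m cdiag (ctr u) u (fun l => (q l)%:C%C))) / 2.
  rewrite -hsDr -mulmxDr cdiagD.
  rewrite (cdiag_ext _ _ (d' := fun l => (2%:C)%C * 1)); last first.
    by move=> l; apply: complex_ext; rewrite ?ReM ?ImM ?ReD ?ImD /= /q; ring.
  by rewrite -cdiagZ cdiag1 // -scalemxAr mulmx1 hsZr [2 * _]mulrC mulfK.
rewrite [leRHS]qE mulrDl lerD2l.
have q0 l : 0 <= q l.
  by rewrite subr_ge0 -[leRHS]mulr1 ler_pM2l //; case/andP: (co01 l).
(* The trace is expanded in the orthonormal eigenbasis [ctr u *m e] of P; each vector contributes q
   l times a product that is at least kappa, as m is within the angle. *)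
have lowQ : kappa * \sum_l q l <=
    hs a (g1 *m D *m cdiag (ctr u) u (fun l => (q l)%:C%C)).
  have -> : hs a (g1 *m D *m cdiag (ctr u) u (fun l => (q l)%:C%C)) =
      hs (a *m ctr u) (g1 *m D *m ctr u *m diag_mx (\row_l (q l)%:C%C)).
    by rewrite hs_mulmr /cdiag !mulmxA.
  rewrite hs_cols mulr_sumr; apply: ler_sum => l _.
  set e : 'cV[C]_n := delta_mx l 0.
  have -> : g1 *m D *m ctr u *m diag_mx (\row_l (q l)%:C%C) *m e =
      (q l)%:C%C *: (g1 *m D *m (ctr u *m e)).
    have de : diag_mx (\row_l (q l)%:C%C) *m e = (q l)%:C%C *: e.
      apply/matrixP => i j; rewrite mul_diag_mx !mxE.
      by case: eqP => [->|_] //=; rewrite !mulr0.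
    by rewrite -(mulmxA _ _ e) de -scalemxAr mulmxA.
  rewrite hsZr mulrC ler_wpM2l // -mulmxA hsC.
  apply: le_trans (wm _ Oa _); rewrite hs_unitaryl //.
  rewrite -sqr_entries_sum (bigD1 l) //= big1 ?addr0.
    by rewrite mxE !eqxx /= expr0n addr0 expr1n mulr1.
  by move=> j jl; rewrite mxE (negbTE jl) /= expr0n addr0.
have dE : hs (g1 - g2) (g1 - g2) = \sum_l (2 - 2 * cos (th l)).
  rewrite g2E -{1 3}[g1]mulmx1 -!mulmxBr hs_unitaryl //.
  rewrite -(cdiag1 (p := ctr u) (q := u)) // cdiagN cdiagD.
  rewrite /cdiag hs_unitaryr // hs_unitaryl //.
  rewrite hsE; apply: eq_bigr => l _; rewrite (bigD1 l) //= big1 ?addr0.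
    rewrite !mxE eqxx !mulr1n !ReD !ImD /=.
    have := cos2Dsin2 (th l); set c := cos _; set s := sin _ => h.
    rewrite (_ : 2 - 2 * c = 1 + 1 - 2 * c); last by ring.
    rewrite -[X in _ = _ + X - _]h; ring.
  by move=> j jl; rewrite !mxE eq_sym (negbTE jl) !mulr0n /= !mulr0 addr0.
rewrite dE.
have : \sum_l (2 - 2 * cos (th l)) <= 4 * \sum_l q l.
  rewrite mulr_sumr; apply: ler_sum => l _.
  have -> : cos (th l) = 2 * co l ^+ 2 - 1.
    rewrite {1}(splitr (th l)) cosD /co -!expr2 sin2cos2; ring.
  exact: sqr_chord_le.
by move=> h; exact: chord_bound_le k0 h lowQ.
Qed.

End Midpoint.

(** * Limits of maximising sequences and their symmetry *)

Section Maximiser.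
Variables (R : realType) (n : nat).
Local Notation C := R[i].
Implicit Types (g a : 'M[C]_n).

(** The limit is the supremum of the lower bounds x k - 1/(k+1), since every x k + 1/(k+1) lies
    above all of them. The explicit rate is kept for the later estimates. *)
Lemma rate_limit (x : nat -> R) :
  (forall k l, (k <= l)%N -> `|x k - x l| <= k.+1%:R^-1) ->
  exists y, forall k, `|x k - y| <= k.+1%:R^-1.
Proof.
move=> hx.
pose A := [set x k - k.+1%:R^-1 | k in [set: nat]].
have ub k : ubound A (x k + k.+1%:R^-1).
  move=> _ [l _ <-].
  have kp : 0 < k.+1%:R^-1 :> R by rewrite invr_gt0 ltr0n.
  have lp : 0 < l.+1%:R^-1 :> R by rewrite invr_gt0 ltr0n.
  have [kl|/ltnW lk] := leqP k l.
    have := hx _ _ kl; rewrite ler_norml => /andP[+ _].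
    by move: kp lp; set e := k.+1%:R^-1; set f := l.+1%:R^-1; lra.
  have := hx _ _ lk; rewrite ler_norml => /andP[_ +].
  by move: kp lp; set e := k.+1%:R^-1; set f := l.+1%:R^-1; lra.
have A0 : A !=set0 by exists (x 0%N - 1^-1), 0%N.
have sA : has_sup A by split=> //; exists (x 0%N + 1%:R^-1); exact: ub.
exists (sup A) => k; rewrite ler_distlC.
have h1 : sup A <= x k + k.+1%:R^-1 by apply: ge_sup => //; exact: ub.
have h2 : x k - k.+1%:R^-1 <= sup A by apply: (sup_upper_bound sA); exists k.
by rewrite h1 h2.
Qed.

Lemma le0_invn (x K : R) : (forall k : nat, x <= K * k.+1%:R^-1) -> x <= 0.
Proof.
move=> hx; rewrite leNgt; apply/negP => x0.
have K0 : 0 < K by have := hx 0%N; rewrite invr1 mulr1; exact: lt_le_trans.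
have := archi_boundP (ltW (divr_gt0 K0 x0)); set N := Num.bound _ => hN.
have := hx N; rewrite leNgt => /negP; apply.
rewrite ltr_pdivrMr ?ltr0n //.
have : K / x < N.+1%:R by rewrite (lt_le_trans hN) // ler_nat.
by rewrite ltr_pdivrMr // mulrC.
Qed.

(** Closedness is stated for the pair of real and imaginary parts, so convergence is checked in that
    space and transported back by injectivity of [mxRI]. *)
Lemma closed_mx_limit (G : set 'M[C]_n) (gs : nat -> 'M[C]_n) g :
  closed_mx G -> (forall k, G (gs k)) ->
  (forall k i j, `|complex.Re (gs k i j) - complex.Re (g i j)| <= k.+1%:R^-1) ->
  (forall k i j, `|complex.Im (gs k i j) - complex.Im (g i j)| <= k.+1%:R^-1) ->
  G g.
Proof.
move=> cG Ggs hre him.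
have cv (f : 'M[C]_n -> 'M[R]_n) :
    (forall k i j, `|f (gs k) i j - f g i j| <= k.+1%:R^-1) ->
    (f (gs k) @[k --> \oo]) --> f g.
  move=> hf; apply/cvg_ballP => e e0.
  near=> k; split=> // i j; rewrite /ball /= distrC (le_lt_trans (hf k i j)) //.
  near: k; exact: near_infty_natSinv_lt (PosNum e0).
have c1 := cv (map_mx (@complex.Re R)); have c2 := cv (map_mx (@complex.Im R)).
have : (@mxRI R n @` G) (mxRI g).
  apply: (@closed_cvg _ _ \oo _ (fun k => mxRI (gs k)) (@mxRI R n @` G)) => //.
    by near=> k; exists (gs k).
  by apply: (cvg_pair (c1 _) (c2 _)) => k i j; rewrite !mxE.
case=> g' Gg' [/matrixP r /matrixP s]; suff <- : g' = g by [].
apply/matrixP => i j; have := r i j; have := s i j; rewrite !mxE => ? ?.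
exact: complex_ext.
Unshelve. all: by end_near. Qed.

Lemma hsD_le (x y : 'M[C]_n) : hs (x + y) (x + y) <= 2 * hs x x + 2 * hs y y.
Proof.
have := hs_ge0 (x - y); rewrite hs_sqB !(hsDr, hsDl) [hs y x]hsC; lra.
Qed.

Lemma hs_entries_le (x : 'M[C]_n) (e : R) : 0 <= e ->
  (forall i j, `|complex.Re (x i j)| <= e) ->
  (forall i j, `|complex.Im (x i j)| <= e) ->
  hs x x <= (n * n)%:R * (2 * e ^+ 2).
Proof.
move=> e0 hr hi; rewrite hsE.
have -> : (n * n)%:R * (2 * e ^+ 2) =
    \sum_(i < n) \sum_(j < n) (2 * e ^+ 2) :> R.
  by rewrite !big_const_ord !iter_addr_0 -mulrnA mulr_natl.
apply: ler_sum => i _; apply: ler_sum => j _; rewrite -!expr2.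
have sq (z : R) : `|z| <= e -> z ^+ 2 <= e ^+ 2.
  by move=> ze; rewrite -real_normK ?num_real // ler_pXn2r ?nnegrE.
by have := sq _ (hr i j); have := sq _ (hi i j); lra.
Qed.

Lemma entry_norm_le (x : 'M[C]_n) (e : R) i j : 0 <= e -> hs x x <= e ^+ 2 ->
  `|complex.Re (x i j)| <= e /\ `|complex.Im (x i j)| <= e.
Proof.
move=> e0 h; have {}h := le_trans (entry_le_hs x i j) h.
split; rewrite -(ler_pXn2r (ltn0Sn 1)) ?nnegrE // real_normK ?num_real //.
  by apply: le_trans h; rewrite lerDl sqr_ge0.
by apply: le_trans h; rewrite lerDr sqr_ge0.
Qed.

(** The assumption on x, z says that O is stable under the inverse of T y = x y z^-1, so T preserves
    superlevel sets. Hence T (gs k) stays close to gs k, and T g = g follows in the limit. *)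
Lemma conjugate_fixed (G O : set 'M[C]_n) (kappa : R) c :
  subgroup_Un G -> closed_mx G -> geodesic_subset G ->
  O `<=` G -> O !=set0 -> 0 < kappa -> G c -> within_angle O kappa c ->
  exists2 g, G g & forall x z, G x -> G z ->
    (forall a, O a -> O (ctr x *m a *m z)) -> x *m g = g *m z.
Proof.
move=> sG cG gG OG O0 k0 Gc wc.
have [GU G1 GM GV] := sG.
have [a0 Oa0] := O0.
(* The superlevel set at height s of the infimum over O of [hs a g], within the angle condition. *)
pose lev s g := [/\ G g, within_angle O kappa g & forall a, O a -> s <= hs a g].
pose A := [set s | exists g, lev s g].
have hs1 g : G g -> hs g g = hs (1%:M : 'M[C]_n) 1%:M.
  by move=> /GU ug; rewrite -[g]mulmx1 hs_unitaryl.
have A0 : A !=set0.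
  exists 0, c; split=> // a Oa; rewrite hsC hs_cols; apply: sumr_ge0 => l _.
  by apply: le_trans (wc _ Oa _); rewrite mulr_ge0 ?hs_ge0 // ltW.
have sA : has_sup A.
  split=> //; exists (hs (1%:M : 'M[C]_n) 1%:M) => s [g [Gg _ /(_ _ Oa0) h]].
  have := hs_ge0 (a0 - g); rewrite hs_sqB (hs1 g) // (hs1 a0); last exact: OG.
  lra.
pose S := sup A.
(* The midpoint reaches level S - e + kappa/8 |g - g'|^2, which cannot exceed S. *)
have close e g g' : lev (S - e) g -> lev (S - e) g' ->
    hs (g - g') (g - g') <= 8 / kappa * e.
  move=> [Gg wg hg] [Gg' wg' hg'].
  have [m [Gm wm hm]] := geodesic_midpoint sG gG OG O0 k0 Gg Gg' wg wg'.
  have : S - e + kappa / 8 * hs (g - g') (g - g') <= S.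
    apply: (sup_upper_bound sA); exists m; split=> // a Oa.
    apply: le_trans (hm _ Oa); rewrite lerD2r ler_pdivlMr // mulr_natr mulr2n.
    by rewrite lerD ?hg ?hg'.
  set x := hs _ _ => h.
  have : kappa * x <= kappa * (8 / kappa * e).
    have -> : kappa * (8 / kappa * e) = 8 * e by field; rewrite gt_eqF.
    lra.
  by rewrite ler_pM2l.
pose d (k : nat) : R := k.+1%:R^-1.
have d0 k : 0 < d k by rewrite invr_gt0 ltr0n.
(* Chosen so that 8 / kappa times [ep k] is d k ^ 2: the level set at S - ep k has diameter at most
   d k. *)
pose ep k := kappa / 8 * d k ^+ 2.
have ep0 k : 0 < ep k by rewrite mulr_gt0 ?exprn_gt0 // divr_gt0.
have /choice [gs gsP] : forall k, exists g, lev (S - ep k) g.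
  move=> k; have [s [g [Gg wg hg]] hs] := sup_adherent (ep0 k) sA.
  exists g; split=> // a Oa; exact: le_trans (ltW hs) (hg _ Oa).
have lev_le s s' g : s <= s' -> lev s' g -> lev s g.
  by move=> ss [? ? h]; split=> // a Oa; exact: le_trans ss (h _ Oa).
have closek k g : lev (S - ep k) g -> hs (gs k - g) (gs k - g) <= d k ^+ 2.
  move=> lg; apply: le_trans (close _ _ _ (gsP k) lg) _.
  rewrite /ep mulrA (_ : 8 / kappa * (kappa / 8) = 1) ?mul1r //.
  by field; rewrite gt_eqF.
have gsC k l : (k <= l)%N -> hs (gs k - gs l) (gs k - gs l) <= d k ^+ 2.
  move=> kl; apply: closek; apply: lev_le (gsP l).
  rewrite lerD2l lerN2 ler_wpM2l ?divr_ge0 ?(ltW k0) //.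
  rewrite ler_pXn2r ?nnegrE ?(ltW (d0 _)) // /d.
  by rewrite lef_pV2 ?posrE ?ltr0n // ler_nat ltnS.
have /choice [re reP] : forall ij : 'I_n * 'I_n, exists y, forall k,
    `|complex.Re (gs k ij.1 ij.2) - y| <= d k.
  move=> [i j]; apply: rate_limit => k l /gsC h /=.
  by have [+ _] := entry_norm_le i j (ltW (d0 k)) h; rewrite !mxE ReD ReN.
have /choice [im imP] : forall ij : 'I_n * 'I_n, exists y, forall k,
    `|complex.Im (gs k ij.1 ij.2) - y| <= d k.
  move=> [i j]; apply: rate_limit => k l /gsC h /=.
  by have [_ +] := entry_norm_le i j (ltW (d0 k)) h; rewrite !mxE ImD ImN.
pose g : 'M[C]_n := \matrix_(i, j) Complex (re (i, j)) (im (i, j)).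
have gre k i j : `|complex.Re (gs k i j) - complex.Re (g i j)| <= d k.
  by rewrite mxE /=; exact: (reP (i, j)).
have gim k i j : `|complex.Im (gs k i j) - complex.Im (g i j)| <= d k.
  by rewrite mxE /=; exact: (imP (i, j)).
exists g.
  by apply: (closed_mx_limit cG (gs := gs)) => // k; case: (gsP k).
move=> x z Gx Gz xz.
have ux := GU _ Gx; have uz := GU _ Gz.
have ucz := unitary_ctr uz.
pose T y := x *m y *m ctr z.
have hsT y y' : hs (T y) (T y') = hs y y' by rewrite hs_unitaryr // hs_unitaryl.
have TK a : a = T (ctr x *m a *m z).
  by rewrite /T !mulmxA unitary_mulV // mul1mx -mulmxA unitary_mulV // mulmx1.
have levT s y : lev s y -> lev s (T y).
  move=> [Gy wy hy]; split.
  - by rewrite /T -unitary_invmx //; exact: (GM _ _ (GM _ _ Gx Gy) (GV _ Gz)).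
  - move=> a Oa v; rewrite (TK a) /T -!mulmxA hs_unitaryl // !mulmxA.
    rewrite -!mulmxA -(hs_unitaryl v v ucz) (mulmxA (ctr x)) (mulmxA _ z) .
    by have := wy _ (xz _ Oa) (ctr z *m v); rewrite !mulmxA.
  - by move=> a Oa; rewrite (TK a) hsT; apply: hy; exact: xz.
suff Tg : T g - g = 0.
  have {}Tg : T g = g by apply/eqP; rewrite -subr_eq0 Tg.
  by rewrite -{2}Tg /T -mulmxA [ctr z *m z]uz mulmx1.
have TB y y' : T (y - y') = T y - T y' by rewrite /T mulmxBr mulmxBl.
pose K : R := (n * n)%:R * 2.
have gK k : hs (gs k - g) (gs k - g) <= K * d k ^+ 2.
  rewrite -mulrA; apply: hs_entries_le => [|i j|i j]; first exact: ltW.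
    by rewrite !mxE ReD ReN; have := gre k i j; rewrite mxE.
  by rewrite !mxE ImD ImN; have := gim k i j; rewrite mxE.
(* Two uses of |x + y|^2 <= 2 |x|^2 + 2 |y|^2 give 2 K + 2 (2 + 2 K) = 6 K + 4 times d k ^ 2, and d
   k <= 1. *)
have bound k : hs (T g - g) (T g - g) <= (6 * K + 4) * k.+1%:R^-1.
  have -> : T g - g = T (g - gs k) + ((T (gs k) - gs k) + (gs k - g)).
    by rewrite TB !addrA subrK subrK.
  apply: le_trans (hsD_le _ _) _; rewrite hsT.
  have h1 := hsD_le (T (gs k) - gs k) (gs k - g).
  have h2 := closek _ _ (levT _ _ (gsP k)).
  have h3 := gK k.
  have e1 : hs (g - gs k) (g - gs k) = hs (gs k - g) (gs k - g).
    by rewrite -hsNN opprB.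
  have e2 : hs (T (gs k) - gs k) (T (gs k) - gs k) =
      hs (gs k - T (gs k)) (gs k - T (gs k)).
    by rewrite -hsNN opprB.
  rewrite e1; rewrite e2 in h1.
  have dd : (6 * K + 4) * d k ^+ 2 <= (6 * K + 4) * d k.
    rewrite ler_wpM2l ?addr_ge0 ?mulr_ge0 ?ler0n // expr2 -[leRHS]mulr1.
    by rewrite ler_wpM2l ?(ltW (d0 k)) // invf_le1 ?ltr0n // ler1n.
  apply: le_trans dd; move: h1 h2 h3; clear.
  move: (hs (gs k - g) _) (hs (gs k - T (gs k)) _) (d k ^+ 2) (hs (_ + _) _).
  by move=> p q r t; lra.
apply/eqP/negP => /negP /hs_gt0; rewrite ltNge => /negP; apply.
exact: le0_invn bound.
Qed.

End Maximiser.

(** * Application to the orbit of u under the two homomorphisms *)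

Theorem theorem5p2 (R : realType) (n : nat)
  (H : Type) (hmul : H -> H -> H) (hone : H) (hinv : H -> H)
  (hmulA : forall a b c, hmul a (hmul b c) = hmul (hmul a b) c)
  (hmul1 : forall a, hmul hone a = a)
  (hmulV : forall a, hmul (hinv a) a = hone)
  (G : set 'M[R[i]]_n)
  (HG : subgroup_Un G) (HGc : closed_mx G) (HGg : geodesic_subset G)
  (phi rho : H -> 'M[R[i]]_n)
  (phiG : forall h, G (phi h)) (rhoG : forall h, G (rho h))
  (phiM : forall a b, phi (hmul a b) = phi a *m phi b)
  (rhoM : forall a b, rho (hmul a b) = rho a *m rho b) :
  (exists u, G u /\
     (radius_in G [set phi h *m u *m invmx (rho h) | h in [set: H]]
        < (pi / 2)%:E)%E) ->
  exists g, G g /\ forall h, phi h = g *m rho h *m invmx g.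
Proof.
have [GU G1 GM GV] := HG.
case=> u [Gu /ereal_inf_lt [_ [r [c [Gc hc]] <-] rpi]].
rewrite lte_fin in rpi; have p0 := pi_gt0 R.
set O := [set _ | _ in _] in hc.
have invG h : invmx (rho h) = ctr (rho h) by apply: unitary_invmx; exact: GU.
have OG : O `<=` G.
  by move=> _ [h _ <-]; exact: (GM _ _ (GM _ _ (phiG h) Gu) (GV _ (rhoG h))).
have O0 : O !=set0 by exists (phi hone *m u *m invmx (rho hone)), hone.
(* With s >= 0, the midpoint r' of s and pi / 2 lies strictly between them: above s as the angle
   bound requires, and in ]0, pi / 2[, so that cos r' > 0. *)
pose s := Num.max r 0.
pose r' := (s + pi / 2) / 2.
have s0 : 0 <= s by rewrite le_max lexx orbT.
have spi : s < pi / 2 by rewrite gt_max rpi divr_gt0.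
have rs : r <= s by rewrite le_max lexx.
have k0 : 0 < cos r'.
  by apply: cos_gt0_pihalf; rewrite /r'; apply/andP; split; lra.
have wc : within_angle O (cos r') c.
  move=> a Oa; apply: (@dinf_le_angle _ _ _ _ s).
  - by apply: le_trans (hc _ Oa) _; rewrite lee_fin.
  - by rewrite /r'; lra.
  - by rewrite /r'; lra.
have [g Gg gfix] := conjugate_fixed HG HGc HGg OG O0 k0 Gc wc.
exists g; split=> // h.
(* By multiplicativity f(1) is a unitary idempotent, hence the identity, and f(h^-1) is the adjoint
   of f(h). *)
have homV (f : H -> 'M[R[i]]_n) : (forall k, G (f k)) ->
    (forall a b, f (hmul a b) = f a *m f b) -> f (hinv h) = ctr (f h).
  move=> fG fM; have uf := GU _ (fG hone); have ufh := GU _ (fG h).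
  have f1 : f hone = 1%:M.
    have := fM hone hone; rewrite hmul1 => /(congr1 (mulmx (ctr (f hone)))).
    by rewrite mulmxA [ctr _ *m _]uf mul1mx => <-.
  have := fM (hinv h) h; rewrite hmulV f1 => /(congr1 (mulmx ^~ (ctr (f h)))).
  by rewrite /= mul1mx -mulmxA unitary_mulV // mulmx1 => <-.
have := gfix (phi h) (rho h) (phiG h) (rhoG h).
(* The orbit point of k is sent to the orbit point of h^-1 k. *)
have Oh a : O a -> O (ctr (phi h) *m a *m rho h).
  move=> [k _ <-]; exists (hmul (hinv h) k) => //.
  rewrite phiM rhoM (homV phi) // unitary_invmx; last first.
    by rewrite -rhoM; exact: GU.
  by rewrite (homV rho) // invG ctrM ctrK !mulmxA.
move=> /(_ Oh) xg; rewrite -xg unitary_invmx; last exact: GU.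
by rewrite -mulmxA unitary_mulV ?mulmx1 //; exact: GU.
Qed.
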